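(* (Weak maximum principle) Let $(\Omega,\mu,d)$ be a metric measure space and let $X=L^p(\Omega)$ with $1\le p\le\infty$, or $X=\mathcal C_b(\Omega)$. Let $J\ge0$ be a kernel such that $K_Ju(x)=\int_\Omega J(x,y)u(y)\,dy$ satisfies $K_J\in\mathcal L(X,X)$, and let $h\in L^\infty(\Omega)$ if $X=L^p(\Omega)$, $h\in\mathcal C_b(\Omega)$ if $X=\mathcal C_b(\Omega)$. For every nonnegative $u_0\in X$, the solution $u$ to the problem $$u_t(x,t)=(K_J-hI)u(x,t),\quad x\in\Omega,\ t>0,\qquad u(x,0)=u_0(x),\quad x\in\Omega,$$ is nonnegative for all $t\ge0$.
   Context: A metric measure space $(\Omega,\mu,d)$ is a metric space $(\Omega,d)$ with a $\sigma$-finite, regular, complete Borel measure $\mu$ that associates a finite positive measure to the balls of $\Omega$. Integration $dy$ is with respect to $\mu$. $\mathcal C_b(\Omega)$ is the space of bounded continuous functions with the sup norm. The solution of the problem is $u(t)=e^{(K_J-hI)t}u_0\in X$. *)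

(* Defs.v *)
From HB Require Import structures.
From mathcomp Require Import all_boot all_order all_algebra.
From mathcomp Require Import all_classical all_reals all_analysis.

Set Implicit Arguments.
Unset Strict Implicit.
Unset Printing Implicit Defensive.
Import Order.TTheory GRing.Theory Num.Theory.
Import numFieldNormedType.Exports.

Local Open Scope classical_set_scope.
Local Open Scope ring_scope.

#[short(type="measurableMetricType")]
HB.structure Definition MeasurableMetric (d : measure_display) (R : realType) :=
  { T of Metric R T & Measurable d T }.

(* "Borel" and "complete": the sigma-algebra of T contains the open sets and the
   mu-negligible sets.  "Regular": outer regular by open sets and inner regular
   by compact sets. *)
Record metric_measure_space (d : measure_display) (R : realType)
    (T : measurableMetricType d R) (mu : {measure set T -> \bar R}) : Prop :=
  MetricMeasureSpace {
    mms_borel : forall U : set T, open U -> measurable U ;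
    mms_complete : measure_is_complete mu ;
    mms_sigma_finite : sigma_finite [set: T] mu ;
    mms_outer_regular : forall E : set T, measurable E ->
      mu E = ereal_inf [set mu U | U in [set U | open U /\ E `<=` U]] ;
    mms_inner_regular : forall E : set T, measurable E ->
      mu E = ereal_sup [set mu K | K in [set K | compact K /\ K `<=` E]] ;
    mms_ball : forall (x : T) (r : R), 0 < r ->
      (0 < mu (ball x r) < +oo)%E
  }.

Variant function_space (R : realType) : Type :=
  | Lp (p : \bar R) of (1 <= p)%E
  | Cb.
Arguments Cb {R}.

Section FunctionSpaces.
Context (d : measure_display) (R : realType) (T : measurableMetricType d R).
Variables (mu : {measure set T -> \bar R}) (X : function_space R).
Implicit Types (u v w h : T -> R) (A : (T -> R) -> (T -> R)) (J : T -> T -> R).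

(* Elements of X are represented by functions T -> R; those of L^p are
   identified when they agree almost everywhere, so pointwise properties are
   understood almost everywhere in L^p and everywhere in C_b. *)
Definition inX u : Prop :=
  match X with
  | Lp p _ => u \in Lfun mu p
  | Cb => continuous u /\ bounded_fun u
  end.

Definition forallX (P : T -> Prop) : Prop :=
  match X with
  | Lp _ _ => \forall x \ae mu, P x
  | Cb => forall x, P x
  end.

Definition normX u : \bar R :=
  match X with
  | Lp p _ => 'N[mu]_p[EFin \o u]%E
  | Cb => ereal_sup [set `|u x|%:E | x in [set: T]]
  end.

Definition eqX u v : Prop := forallX (fun x => u x = v x).

Definition nonnegX u : Prop := forallX (fun x => 0 <= u x).

Definition multiplierX h : Prop :=
  match X with
  | Lp _ _ => h \in Lfun mu +oo%E
  | Cb => continuous h /\ bounded_fun h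
  end.

(* A \in L(X, X), for an operator A given on representatives *)
Record bounded_linear_op A : Prop := BoundedLinearOp {
  blo_inX : forall u, inX u -> inX (A u) ;
  blo_eqX : forall u v, inX u -> inX v -> eqX u v -> eqX (A u) (A v) ;
  blo_linear : forall (a : R) u v, inX u -> inX v ->
    eqX (A (fun x => a * u x + v x)) (fun x => a * A u x + A v x) ;
  blo_bounded : exists C : R, forall u, inX u ->
    (normX (A u) <= C%:E * normX u)%E
}.

Definition kernel_op J u : T -> R := fun x => (\int[mu]_y (J x y * u y))%R.

(* The real-valued integral is a total function, so the convergence of the
   integrals defining K_J u is a separate requirement. *)
Definition kernel_op_defined J : Prop := forall u, inX u ->
  forallX (fun x => mu.-integrable [set: T] (fun y => (J x y * u y)%:E)).

Definition nonlocal_op J h u : T -> R := fun x => kernel_op J u x - h x * u x.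

(* v = e^{tA} u0 in X: the exponential series applied to u0 has sum v for the
   norm of X *)
Definition is_exp_op A (t : R) u0 v : Prop :=
  inX v /\
  normX (fun x => \sum_(k < n) (t ^+ k / k`!%:R) * iter k A u0 x - v x)
    @[n --> \oo] --> 0%E.

(* u : [0, +oo[ -> X is a solution of u_t = A u for t > 0, u(0) = u0, the time
   derivative being taken in X; values of u at negative times are irrelevant *)
Record is_solution A u0 (u : R -> T -> R) : Prop := IsSolution {
  sol_inX : forall t, 0 <= t -> inX (u t) ;
  sol_init : eqX (u 0) u0 ;
  sol_cvg0 : normX (fun x => u t x - u0 x) @[t --> 0^'+] --> 0%E ;
  sol_deriv : forall t, 0 < t ->
    normX (fun x => s^-1 * (u (t + s) x - u t x) - A (u t) x)
      @[s --> 0^'] --> 0%E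
}.

End FunctionSpaces.

(* Main.v *)
Require Import Defs.
From mathcomp Require Import all_boot all_order all_algebra.
From mathcomp Require Import all_classical all_reals all_analysis.
From mathcomp Require Import ess_sup_inf measurable_realfun ring lra.

(** Write A = K_J - hI and let u be a curve in X starting at u0 >= 0.  The
    quantity to control is phi(t) = ||u(t)^-||.  For small s > 0,

      u(t + s) = (1 - s h) u(t) + s K_J u(t) + r,
      r = u(t + s) - u(t) - s A u(t),

    and 1 - s h >= 0 because h is bounded, while K_J u >= - K_J u^- because
    J >= 0.  Taking negative parts and norms,

      phi(t + s) <= (1 + c s) phi(t) + ||r||,   c = ||h|| + ||K_J||

    (rnormX_funrneg_step).  If u solves u' = A u up to an error of norm at most
    eta, then ||r|| <= s (eta + o(1)); since phi is continuous and phi(0) = 0, a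
    Gronwall argument with one-sided increments (gronwall_one_sided) gives
    phi(b) <= eta e^{L b}, with L depending on J and h only
    (approximate_maximum_principle).

    A solution of the Cauchy problem is the case eta = 0.  For the exponential
    series, the partial sums S_n(t) = sum_(k < n) t^k/k! A^k u0 are polynomial
    in t and start at u0, and satisfy S_(m+1)' = A S_(m+1) - t^m/m! A^(m+1) u0,
    so they are approximate solutions with an error that tends to 0 with m
    (exp_sum_deriv, exp_sum_error_cvg0).  Hence ||S_n(t)^-|| tends to 0, and a
    limit v of S_n(t) in X has ||v^-|| = 0.

    Only the order and norm structure of X enters: X is closed under linear
    combinations, absolute values and multiplication by h, and its norm is
    monotone in |u|.  L^p and C_b are treated separately only in the proof of
    these facts. *)

Import Order.TTheory GRing.Theory Num.Theory.
Import numFieldNormedType.Exports.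

Local Open Scope classical_set_scope.
Local Open Scope ring_scope.

Set Implicit Arguments.
Unset Strict Implicit.

(** * A Gronwall inequality for one-sided increments *)

(** The comparison function psi(t) = eta e^{(c+1)t} grows strictly faster than
    the increment bound allows phi to grow wherever phi <= psi, because
    psi(t + s) >= psi(t) (1 + (c + 1) s) and psi >= eta.  So the infimum t0 of
    the times at which phi > psi can neither be 0, nor have phi t0 > psi t0 (by
    the left semicontinuity hypothesis), nor have phi t0 <= psi t0 (since then
    phi <= psi a little beyond t0). *)
Lemma gronwall_one_sided (R : realType) (phi : R -> R) (c eta b : R) :
  0 < b -> 0 <= c -> 0 < eta ->
  (forall e : R, 0 < e -> \forall t \near 0^'+, phi t <= e) ->
  (forall t e : R, 0 < t -> t <= b -> 0 < e ->
     \forall s \near 0^'+, phi t <= phi (t - s) + e) ->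
  (forall t : R, 0 < t -> t < b ->
     \forall s \near 0^'+, phi (t + s) <= (1 + c * s) * phi t + eta * s) ->
  phi b <= eta * expR ((c + 1) * b).
Proof.
move=> b0 c0 eta0 phi0 phil phir; rewrite leNgt; apply/negP => bad.
pose psi t := eta * expR ((c + 1) * t).
have le_psi s t : s <= t -> psi s <= psi t.
  by move=> st; rewrite ler_wpM2l ?(ltW eta0)// ler_expR ler_wpM2l// addr_ge0.
have psi_ge (t : R) : 0 <= t -> eta <= psi t.
  by move=> t0; apply: le_trans (le_psi _ _ t0); rewrite /psi mulr0 expR0 mulr1.
pose S := [set t : R | 0 < t <= b /\ psi t < phi t].
have Sb : S b by split; rewrite ?b0 ?lexx.
have S_inf : has_inf S.
  by split; [exists b|exists 0 => t [/andP[/ltW]]].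
set t0 := inf S.
have t0b : t0 <= b by apply: ge_inf => //; case: S_inf.
have lt0 (t : R) : 0 < t -> t < t0 -> phi t <= psi t.
  move=> tp tt0; rewrite leNgt; apply/negP => lt.
  have : t0 <= t.
    apply: ge_inf; first by case: S_inf.
    by split=> //; rewrite tp (ltW (lt_le_trans tt0 t0b)).
  by rewrite leNgt tt0.
have t0_gt0 : 0 < t0.
  have := phi0 _ eta0; rewrite /= near_withinE => -[r /= r0 hr].
  apply: (lt_le_trans r0); apply: lb_le_inf; first by exists b.
  move=> t [/andP[tp _] lt]; rewrite leNgt; apply/negP => tr.
  have := hr t; rewrite /ball_ /= sub0r normrN gtr0_norm// => /(_ tr tp).
  by rewrite leNgt (le_lt_trans (psi_ge _ (ltW tp)) lt).
have phit0 : phi t0 <= psi t0.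
  apply/ler_addgt0Pr => e e0.
  near (0 : R)^'+ => s.
  apply: (@le_trans _ _ (phi (t0 - s) + e)).
    by near: s; apply: phil.
  rewrite lerD2r; apply: (@le_trans _ _ (psi (t0 - s))).
    apply: lt0; last by rewrite gtrBl; near: s; exact: nbhs_right_gt.
    by rewrite subr_gt0; near: s; exact: nbhs_right_lt.
  by apply: le_psi; rewrite gerBl ltW//; near: s; exact: nbhs_right_gt.
have {}t0b : t0 < b.
  rewrite lt_neqAle; apply/andP; split=> //.
  by apply: contraTneq bad => <-; rewrite -leNgt.
have := phir _ t0_gt0 t0b; rewrite near_withinE => -[r /= r0 hr].
have : t0 + r <= inf S.
  apply: lb_le_inf; first by exists b.
  move=> t St; rewrite leNgt; apply/negP => tr.
  have t0t : t0 <= t by apply: ge_inf => //; case: S_inf.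
  have [t0E|t0N] := eqVneq t0 t; last first.
    have {}t0t : t0 < t by rewrite lt_neqAle t0N.
    have := hr (t - t0); rewrite /ball_ /= sub0r normrN gtr0_norm ?subr_gt0//.
    rewrite ltrBlDl => /(_ tr t0t); rewrite addrC subrK leNgt => /negP; apply.
    case: St => _; apply: le_lt_trans.
    set s := t - t0; have s0 : 0 < s by rewrite subr_gt0.
    have ->: psi t = psi t0 * expR ((c + 1) * s).
      by rewrite /psi -mulrA -expRD; congr (_ * expR _); rewrite /s; ring.
    apply: (@le_trans _ _ (psi t0 * (1 + (c + 1) * s))); last first.
      by rewrite ler_wpM2l ?expR_ge1Dx// (le_trans (ltW eta0))// psi_ge// ltW.
    have := psi_ge _ (ltW t0_gt0).
    have cs : 0 <= c * s by rewrite mulr_ge0// ltW.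
    nra.
  by case: St => _; rewrite -t0E ltNge phit0.
by rewrite leNgt ltrDl r0.
Unshelve. all: by end_near. Qed.

(** * Limits in the time variable *)

Lemma near_dnbhs_right (R : realType) (P : R -> Prop) :
  (\forall s \near 0^', P s) -> \forall s \near 0^'+, P s.
Proof.
rewrite !near_withinE; apply: filterS => s hs s0; apply: hs.
by rewrite gt_eqF.
Qed.

Lemma near_dnbhs_left (R : realType) (P : R -> Prop) :
  (\forall s \near 0^', P s) -> \forall s \near 0^'+, P (- s).
Proof.
rewrite !near_withinE => -[r /= r0 hr]; exists r => // s /=.
rewrite sub0r normrN => sr s0; apply: hr; rewrite /= ?sub0r ?opprK//.
by rewrite oppr_eq0 gt_eqF.
Qed.

(** This is the derivative of [exp_coeff t k] with respect to [t]. *)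
Definition prev_exp_coeff (R : realType) (t : R) (k : nat) : R :=
  if k is j.+1 then exp_coeff t j else 0.

Lemma exp_coeff_quotient_cvg (R : realType) k (t : R) :
  s^-1 * (exp_coeff (t + s) k - exp_coeff t k) - prev_exp_coeff t k
    @[s --> 0^'] --> 0.
Proof.
have q : (fun s => s^-1 * ((t + s) ^+ k - t ^+ k)) @ 0^' --> k%:R * t ^+ k.-1.
  have : derivable (@GRing.exp R ^~ k) t 1 by exact: exprn_derivable.
  rewrite /derivable => /cvg_ex[l hl].
  have lE : l = k%:R * t ^+ k.-1.
    have := @exp_derive _ k t 1; rewrite [RHS]mulr1; apply: etrans.
    by rewrite /derive; apply/esym/cvg_lim.
  rewrite -lE (_ : (fun s => _) = fun s : R =>
    s^-1 *: (((@GRing.exp R ^~ k) \o shift t) (s *: 1) - t ^+ k)) //.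
  by apply/funext => s; rewrite /GRing.scale/= mulr1 [t + s]addrC.
have c : (fun=> k`!%:R^-1) @ (0 : R)^' --> (k`!%:R^-1 : R) by exact: cvg_cst.
have /(_ _) := cvgM q c.
have -> : k%:R * t ^+ k.-1 * k`!%:R^-1 = prev_exp_coeff t k.
  case: k {q c} => [|k]; first by rewrite !mul0r.
  rewrite /prev_exp_coeff /exp_coeff /= factS natrM; field.
  by rewrite [1 + _]addrC natr1 !pnatr_eq0 -lt0n fact_gt0.
move=> h; apply/subr_cvg0; rewrite (_ : (fun s => _) =
  ((fun s => s^-1 * ((t + s) ^+ k - t ^+ k)) \* (fun=> k`!%:R^-1))) //.
by apply/funext => s; rewrite /exp_coeff /=; ring.
Qed.

Lemma exp_coeff_cvg0 (R : realType) k :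
  exp_coeff t k - exp_coeff 0 k @[t --> (0 : R)^'+] --> 0.
Proof.
apply/subr_cvg0; apply: cvg_at_right_filter.
apply: (@cvgM _ _ _ _ (@GRing.exp R ^~ k) (fun=> k`!%:R^-1)).
  exact: exprn_continuous.
exact: cvg_cst.
Qed.

(** * The order and norm structure shared by L^p and C_b *)

Lemma bounded_funP (T : Type) (R : realType) (f : T -> R) :
  bounded_fun f <-> exists M, forall x, `|f x| <= M.
Proof.
split=> [[M [_ hM]]|[M hM]].
  by exists (M + 1) => x; apply: (hM (M + 1)) => //; rewrite ltrDl.
exists M; split; first exact: num_real.
by move=> N MN x _ /=; apply: le_trans (hM x) (ltW MN).
Qed.

Lemma le_Lnorm d (T : measurableType d) (R : realType)
    (mu : {measure set T -> \bar R}) (p : \bar R) (f g : T -> R) :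
  (1 <= p)%E -> measurable_fun setT f -> measurable_fun setT g ->
  (\forall x \ae mu, `|f x| <= `|g x|) ->
  ('N[mu]_p[EFin \o f] <= 'N[mu]_p[EFin \o g])%E.
Proof.
rewrite unlock; case: p => [r||//] r1 mf mg fg /=.
  have r0 : 0 <= r by rewrite (le_trans ler01).
  have int_ge0 (k : T -> R) : (\int[mu]_x (`|(k x)%:E| `^ r) \in `[0, +oo])%E.
    by rewrite in_itv/= leey andbT integral_ge0// => x _; exact: poweR_ge0.
  apply: gt0_ler_poweR; rewrite ?invr_ge0 ?int_ge0//.
  have mpow (k : T -> R) : measurable_fun setT k ->
      measurable_fun setT (fun x => `|(k x)%:E| `^ r)%E.
    move=> mk; apply: (@measurableT_comp _ _ _ _ _ _ (fun x => (x `^ r)%E)) => //=.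
      exact: measurable_poweR.
    by apply: measurableT_comp => //; exact: measurableT_comp.
  apply: ae_ge0_le_integral => //=; [exact: mpow|exact: mpow|].
  apply: filterS fg => x fgx _; rewrite !lee_fin.
  by rewrite ge0_ler_powR// nnegrE.
case: ifPn => // mu0; apply: le_ess_sup; apply: filterS fg => x fgx /=.
by rewrite lee_fin.
Qed.

(** The norm of X is finite on X, so estimates are carried out with real
    numbers. *)
Definition rnormX (d : measure_display) (R : realType)
    (T : measurableMetricType d R) (mu : {measure set T -> \bar R})
    (X : function_space R) (u : T -> R) : R :=
  fine (normX mu X u).

Section FunctionSpaceLattice.
Context (d : measure_display) (R : realType) (T : measurableMetricType d R).
Context (mu : {measure set T -> \bar R}) (X : function_space R).
Implicit Types (u v w h : T -> R).

Lemma forallX_mono (P Q : T -> Prop) :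
  (forall x, P x -> Q x) -> forallX mu X P -> forallX mu X Q.
Proof. by case: X => [p p1|] PQ /=; [exact: filterS|move=> + x => /(_ x)/PQ]. Qed.

Lemma forallX_and (P Q : T -> Prop) :
  forallX mu X P -> forallX mu X Q -> forallX mu X (fun x => P x /\ Q x).
Proof. by case: X => [p p1|] /=; [exact: filterI|split]. Qed.

Lemma forallXW (P : T -> Prop) : (forall x, P x) -> forallX mu X P.
Proof. by case: X => [p p1|] // hP /=; exact: nearW. Qed.

Lemma Lfun_measurable p u : u \in Lfun mu p -> measurable_fun setT u.
Proof. by move=> /sub_Lfun_mfun/set_mem. Qed.

Lemma in_Lfun p u : measurable_fun setT u -> ('N[mu]_p[EFin \o u] < +oo)%E ->
  u \in Lfun mu p.
Proof. by move=> um u_fin; apply/andP; split; apply: mem_set. Qed.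

Lemma inX_lin (a : R) u v : inX mu X u -> inX mu X v ->
  inX mu X (fun x => a * u x + v x).
Proof.
case: X => [p p1|] /=.
  move=> uL vL.
  have [_ hL] := Lfun_submod_closed mu p1.
  exact: (hL a u v uL vL).
move=> [uc /bounded_funP[M hM]] [vc /bounded_funP[N hN]]; split.
  move=> x; apply: cvgD; last exact: vc.
  by apply: cvgM; [exact: cvg_cst|exact: uc].
apply/bounded_funP; exists (`|a| * M + N) => x.
by rewrite (le_trans (ler_normD _ _))// lerD// normrM ler_wpM2l.
Qed.

Lemma inX_abs u : inX mu X u -> inX mu X (fun x => `|u x|).
Proof.
case: X => [p p1|] /=.
  move=> uL; apply: in_Lfun.
    by apply: measurableT_comp => //; exact: Lfun_measurable uL.
  have := sub_Lfun_finLfun uL => /set_mem /=; apply: le_lt_trans.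
  apply: le_Lnorm => //; last by apply: nearW => x; rewrite normr_id.
    by apply: measurableT_comp => //; exact: Lfun_measurable uL.
  exact: Lfun_measurable uL.
move=> [uc /bounded_funP[M hM]]; split.
  by move=> x; apply: (@cvg_norm _ R^o); exact: uc.
by apply/bounded_funP; exists M => x; rewrite normr_id.
Qed.

Lemma normX_ge0 u : (0 <= normX mu X u)%E.
Proof.
case: X => [p p1|] /=; first exact: Lnorm_ge0.
apply: (@le_trans _ _ (`|u point|%:E)%E); first by rewrite lee_fin.
by apply: ereal_sup_ubound; exists point.
Qed.

Lemma normX_fin u : inX mu X u -> normX mu X u \is a fin_num.
Proof.
rewrite ge0_fin_numE ?normX_ge0//.
case: X => [p p1|] /=; first by move=> /sub_Lfun_finLfun/set_mem.
move=> [_ /bounded_funP[M hM]]; apply: (@le_lt_trans _ _ M%:E); last exact: ltry.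
by apply: ge_ereal_sup => _ [x _ <-]; rewrite lee_fin.
Qed.

Local Notation nrm := (rnormX mu X).

Lemma rnormX_ge0 u : 0 <= nrm u.
Proof. by rewrite fine_ge0// normX_ge0. Qed.

Lemma normXE u : inX mu X u -> normX mu X u = (nrm u)%:E.
Proof. by move=> uX; rewrite fineK// normX_fin. Qed.

Lemma le_rnormX u v : inX mu X u -> inX mu X v ->
  forallX mu X (fun x => `|u x| <= `|v x|) -> nrm u <= nrm v.
Proof.
move=> uX vX uv; apply: fine_le; rewrite ?normX_fin//.
move: uX vX uv; case: X => [p p1|] /=.
  move=> uL vL uv; apply: le_Lnorm uv => //.
    exact: Lfun_measurable uL.
  exact: Lfun_measurable vL.
move=> _ _ uv; apply: ge_ereal_sup => _ [x _ <-].
apply: (@le_trans _ _ (`|v x|%:E)%E); first by rewrite lee_fin.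
by apply: ereal_sup_ubound; exists x.
Qed.

Lemma rnormX_lin a u v : inX mu X u -> inX mu X v ->
  nrm (fun x => a * u x + v x) <= `|a| * nrm u + nrm v.
Proof.
move=> uX vX; rewrite -lee_fin EFinD EFinM -!normXE//; last exact: inX_lin.
move: uX vX; case: X => [p p1|] /=.
  move=> uL vL.
  rewrite -(LnormZ (Lfun_Sub p1 uL) a); apply: eminkowski => //.
    by apply: measurable_funM => //; exact: Lfun_measurable uL.
  exact: Lfun_measurable vL.
move=> _ _; apply: ge_ereal_sup => _ [x _ <-].
apply: (@le_trans _ _ (`|a|%:E * `|u x|%:E + `|v x|%:E)%E).
  by rewrite -EFinM -EFinD lee_fin (le_trans (ler_normD _ _))// normrM.
apply: leeD; last by apply: ereal_sup_ubound; exists x.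
by apply: lee_wpmul2l; [rewrite lee_fin|apply: ereal_sup_ubound; exists x].
Qed.

Lemma rnormX_eq0 u : inX mu X u -> nrm u = 0 -> forallX mu X (fun x => u x = 0).
Proof.
move=> uX u0; have : normX mu X u = 0%E by rewrite normXE// u0.
move: uX {u0}; case: X => [p p1|] /=.
  move=> uL /Lnorm_eq0_eq0 h.
  have /h : measurable_fun setT (EFin \o u).
    by apply: measurableT_comp => //; exact: Lfun_measurable uL.
  by move=> /(_ (lt_le_trans lte01 p1)); apply: filterS => x /(_ I) [].
move=> _ u0 x; have : (`|u x|%:E <= 0)%E.
  by rewrite -u0; apply: ereal_sup_ubound; exists x.
by rewrite lee_fin normr_le0 => /eqP.
Qed.

Lemma rnormX_ext u v : inX mu X u -> inX mu X v -> eqX mu X u v -> nrm u = nrm v.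
Proof.
move=> uX vX uv; apply/eqP; rewrite eq_le.
by rewrite !le_rnormX//; apply: forallX_mono uv => x ->.
Qed.

Lemma inX_scale a u : inX mu X u -> inX mu X (fun x => a * u x).
Proof.
move=> uX; have := inX_lin (a - 1) uX uX; congr inX.
by apply/funext => x; ring.
Qed.

Lemma inX_add u v : inX mu X u -> inX mu X v -> inX mu X (fun x => u x + v x).
Proof.
move=> uX vX; have := inX_lin 1 uX vX; congr inX.
by apply/funext => x; ring.
Qed.

Lemma inX_sub u v : inX mu X u -> inX mu X v -> inX mu X (fun x => u x - v x).
Proof.
move=> uX vX; have := inX_lin (-1) vX uX; congr inX.
by apply/funext => x; ring.
Qed.

Lemma inX0 u : inX mu X u -> inX mu X (fun=> 0).
Proof.
move=> uX; have := inX_sub uX uX; congr inX.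
by apply/funext => x; ring.
Qed.

Lemma inX_sum n (c : nat -> R) (f : nat -> T -> R) :
  (forall k, inX mu X (f k)) ->
  inX mu X (fun x => \sum_(k < n) c k * f k x).
Proof.
move=> fX; elim: n => [|n ih].
  have := inX0 (fX 0); congr inX.
  by apply/funext => x; rewrite big_ord0.
have := inX_lin (c n) (fX n) ih; congr inX.
by apply/funext => x; rewrite big_ord_recr addrC.
Qed.

Lemma rnormX0 : nrm (fun=> 0) = 0.
Proof.
rewrite /rnormX /normX; case: X => [p p1|] /=.
  by rewrite (Lnorm0 mu) ?gt_eqF// (lt_le_trans lte01).
rewrite (_ : [set _ | _ in _] = [set 0%E]) ?ereal_sup1//.
apply/seteqP; split=> [_ [x _ <-]|_ ->]; first by rewrite normr0.
by exists point => //; rewrite normr0.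
Qed.

Lemma rnormXZ a u : inX mu X u -> nrm (fun x => a * u x) <= `|a| * nrm u.
Proof.
move=> uX; have := rnormX_lin a uX (inX0 uX); rewrite rnormX0 addr0.
by congr (nrm _ <= _); apply/funext => x; rewrite addr0.
Qed.

(** Positive and negative parts are expressed by absolute values, so that they
    stay in X as soon as absolute values do. *)
Lemma inX_funrpos u : inX mu X u -> inX mu X u^\+.
Proof.
move=> uX; have := inX_scale 2^-1 (inX_add (inX_abs uX) uX).
congr inX; apply/funext => x; rewrite /funrpos.
have [ux|ux] := leP 0 (u x).
  by rewrite ger0_norm//; field.
by rewrite ltr0_norm//; field.
Qed.

Lemma inX_funrneg u : inX mu X u -> inX mu X u^\-.
Proof.
move=> uX; have := inX_sub (inX_funrpos uX) uX; congr inX.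
apply/funext => x; rewrite /funrpos /funrneg.
by case: (leP 0 (u x)) => ux; case: (leP 0 (- u x)) => ux'; lra.
Qed.

Lemma multiplier_bound h : multiplierX mu X h ->
  exists2 H, 0 <= H & forallX mu X (fun x => `|h x| <= H).
Proof.
case: X => [p p1|] /=; last first.
  move=> [_ /bounded_funP[M hM]]; exists M => //.
  exact: le_trans (normr_ge0 _) (hM point).
move=> hL; have h_fin : ('N[mu]_+oo[EFin \o h] < +oo)%E.
  by have := sub_Lfun_finLfun hL => /set_mem.
have h_ge : \forall x \ae mu, (`|h x|%:E <= 'N[mu]_+oo[EFin \o h])%E.
  rewrite unlock; case: ifPn => [_|mu0]; first exact: ess_sup_ge.
  (* the norm of L^oo is set to 0 on a null space, where the whole space is
     negligible *)
  exists setT; split => //.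
  by apply/eqP; rewrite eq_le measure_ge0 andbT leNgt.
exists (fine 'N[mu]_+oo[EFin \o h]); first by rewrite fine_ge0// Lnorm_ge0.
apply: filterS h_ge => x; rewrite -lee_fin fineK//.
by rewrite ge0_fin_numE// Lnorm_ge0.
Qed.

Lemma inX_mul h u : multiplierX mu X h -> inX mu X u ->
  inX mu X (fun x => h x * u x).
Proof.
move=> hM uX; have [H H0 hH] := multiplier_bound hM.
move: hM uX (inX_scale H uX) hH; case: X => [p p1|] /=; last first.
  move=> [hc _] [uc /bounded_funP[M uM]] _ hH; split.
    by move=> x; apply: cvgM; [exact: hc|exact: uc].
  by apply/bounded_funP; exists (H * M) => x; rewrite normrM ler_pM.
move=> hL uL HuL hH; have mh := Lfun_measurable hL.
have um := Lfun_measurable uL.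
apply: in_Lfun; first exact: measurable_funM.
have := sub_Lfun_finLfun HuL => /set_mem /=; apply: le_lt_trans.
apply: le_Lnorm => //; first exact: measurable_funM.
  exact: Lfun_measurable HuL.
apply: filterS hH => x hx; rewrite !normrM (ger0_norm H0).
exact: ler_wpM2r.
Qed.

Lemma cvg_normX_near (I : Type) (F : set_system I) {FF : Filter F}
    (f : I -> T -> R) :
  normX mu X (f i) @[i --> F] --> 0%E ->
  forall e : R, 0 < e -> \forall i \near F, nrm (f i) < e.
Proof.
move=> /fine_cvgP[_ /cvgr0_norm_lt h] e e0.
apply: filterS (h _ e0) => i /=; rewrite ger0_norm//.
exact: rnormX_ge0.
Qed.

(** Since u^- <= v^- + |v - u| pointwise, the map u |-> ||u^-|| is
    1-Lipschitz. *)
Lemma rnormX_funrneg_le u v : inX mu X u -> inX mu X v ->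
  nrm u^\- <= nrm v^\- + nrm (fun x => v x - u x).
Proof.
move=> uX vX; have vuX := inX_sub vX uX.
have nX := inX_funrneg vX.
have aX := inX_abs vuX.
have /le_trans : nrm u^\- <= nrm (fun x => 1 * v^\- x + `|v x - u x|).
  apply: le_rnormX; [exact: inX_funrneg|exact: inX_lin|apply: forallXW => x].
  rewrite ger0_norm// ger0_norm ?addr_ge0 ?mulr_ge0// mul1r /funrneg.
  have := ler_norm (v x - u x); have := normr_ge0 (v x - u x).
  by case: (leP 0 (- u x)) => ?; case: (leP 0 (- v x)) => ?; lra.
apply; apply: le_trans (rnormX_lin _ nX aX) _.
rewrite normr1 mul1r lerD2l; apply: le_rnormX => //.
by apply: forallXW => x; rewrite normr_id.
Qed.

Lemma rnormX_funrneg0 u : inX mu X u -> nonnegX mu X u -> nrm u^\- = 0.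
Proof.
move=> uX u0; rewrite -rnormX0; apply: rnormX_ext.
- exact: inX_funrneg.
- exact: inX0 uX.
- by apply: forallX_mono u0 => x ux; rewrite /funrneg max_r// oppr_le0.
Qed.

Lemma nonnegX_funrneg u : inX mu X u -> nrm u^\- <= 0 -> nonnegX mu X u.
Proof.
move=> uX un; have nX := inX_funrneg uX.
have /(rnormX_eq0 nX) : nrm u^\- = 0.
  by apply/eqP; rewrite eq_le un rnormX_ge0.
apply: forallX_mono => x; rewrite /funrneg => ux.
by rewrite -oppr_le0 -ux le_max lexx.
Qed.

Lemma rnormX_sum n (c : nat -> R) (f : nat -> T -> R) :
  (forall k, inX mu X (f k)) ->
  nrm (fun x => \sum_(k < n) c k * f k x) <= \sum_(k < n) `|c k| * nrm (f k).
Proof.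
move=> fX; elim: n => [|n ih].
  rewrite big_ord0 (_ : (fun _ => _) = fun=> 0) ?rnormX0//.
  by apply/funext => x; rewrite big_ord0.
rewrite big_ord_recr/= (_ : (fun _ => _) =
  fun x => c n * f n x + \sum_(k < n) c k * f k x); last first.
  by apply/funext => x; rewrite big_ord_recr addrC.
apply: le_trans (rnormX_lin _ (fX n) (inX_sum n c fX)) _.
by rewrite [leRHS]addrC lerD2l.
Qed.

(** A fixed finite family combined with coefficients that tend to 0 tends to 0 in
    X; applied to polynomial curves, it reduces their continuity and
    differentiability in X to those of the scalar coefficients. *)
Lemma rnormX_sum_near (I : Type) (F : set_system I) {FF : Filter F} n
    (c : nat -> I -> R) (f : nat -> T -> R) :
  (forall k, inX mu X (f k)) -> (forall k, c k i @[i --> F] --> 0) ->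
  forall e : R, 0 < e ->
  \forall i \near F, nrm (fun x => \sum_(k < n) c k i * f k x) <= e.
Proof.
move=> fX c0 e e0.
have cv : (fun i => \sum_(k < n) `|c k i| * nrm (f k)) @ F --> 0.
  elim: n => [|n ih].
    by under eq_fun do rewrite big_ord0; exact: cvg_cst.
  under eq_fun do rewrite big_ord_recr/=.
  have cn : (fun i => `|c n i| * nrm (f n)) @ F --> 0.
    have cst : (fun=> nrm (f n)) @ F --> nrm (f n) by exact: cvg_cst.
    have nc := @cvg_norm _ R^o _ F FF _ _ (c0 n).
    by have /(_ FF) := cvgM nc cst; rewrite normr0 mul0r.
  by have /(_ FF) := cvgD ih cn; rewrite addr0.
have /cvgr0_norm_lt/(_ _ e0) := cv; apply: filterS => i /= ie.
apply: le_trans (rnormX_sum n (fun k => c k i) fX) _.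
by apply: le_trans (ltW ie); exact: ler_norm.
Qed.

Lemma blo_rnormX A : bounded_linear_op mu X A ->
  exists2 M, 0 <= M & forall u, inX mu X u -> nrm (A u) <= M * nrm u.
Proof.
move=> [AX _ _ [C hC]]; exists `|C| => // u uX.
have := hC u uX; rewrite !normXE//; last exact: AX.
rewrite -EFinM lee_fin => /le_trans; apply.
by rewrite ler_wpM2r ?rnormX_ge0// ler_norm.
Qed.

(** Linearity is available only up to [eqX], hence finite sums require this
    separate statement.  The empty sum is written as -1 * z + z to apply the
    two-term linearity to it. *)
Lemma blo_sum A n (c : nat -> R) (f : nat -> T -> R) :
  bounded_linear_op mu X A -> (forall k, inX mu X (f k)) ->
  eqX mu X (A (fun x => \sum_(k < n) c k * f k x))
           (fun x => \sum_(k < n) c k * A (f k) x).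
Proof.
move=> Abl fX; elim: n => [|n ih].
  have zX := inX_sum 0 c fX.
  apply: forallX_mono (blo_linear Abl (-1) zX zX) => x; rewrite big_ord0.
  set z := (fun x : T => _) in zX *.
  rewrite (_ : (fun x => -1 * z x + z x) = z); last first.
    by apply/funext => y; rewrite mulN1r addNr /z big_ord0.
  by rewrite mulN1r addNr.
have sX := inX_sum n c fX.
have := blo_linear Abl (c n) (fX n) sX.
rewrite (_ : (fun x => c n * f n x + _) =
  (fun x => \sum_(k < n.+1) c k * f k x)); last first.
  by apply/funext => x; rewrite big_ord_recr addrC.
move=> lin; apply: forallX_mono (forallX_and ih lin) => x [ihx ->].
by rewrite ihx big_ord_recr addrC.
Qed.

End FunctionSpaceLattice.

(** * The maximum principle for approximate solutions *)

Section MaximumPrinciple.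
Context (d : measure_display) (R : realType) (T : measurableMetricType d R).
Context (mu : {measure set T -> \bar R}) (X : function_space R).
Context (J : T -> T -> R) (h : T -> R).
Context (J_ge0 : forall x y, 0 <= J x y).
Context (K_blo : bounded_linear_op mu X (kernel_op mu J)).
Context (h_mul : multiplierX mu X h).
Local Notation nrm := (rnormX mu X).
Local Notation A := (nonlocal_op mu J h).

Lemma nonlocal_op_blo : bounded_linear_op mu X A.
Proof.
have [H H0 hH] := multiplier_bound h_mul.
have KX := blo_inX K_blo.
have hX u : inX mu X u -> inX mu X (fun x => h x * u x) by exact: inX_mul.
split.
- by move=> u uX; apply: inX_sub; [exact: KX|exact: hX].
- move=> u v uX vX uv.
  apply: forallX_mono (forallX_and uv (blo_eqX K_blo uX vX uv)).
  by move=> x [ux kx]; rewrite /nonlocal_op ux kx.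
- move=> a u v uX vX; apply: forallX_mono (blo_linear K_blo a uX vX) => x kx.
  by rewrite /nonlocal_op kx; ring.
have [C C0 hC] := blo_rnormX K_blo.
exists (H + C) => u uX.
have uhX := hX _ uX; have uKX := KX _ uX.
rewrite !normXE//; last exact: inX_sub.
rewrite -EFinM lee_fin.
rewrite (_ : A u = fun x => -1 * (h x * u x) + kernel_op mu J u x); last first.
  by apply/funext => x; rewrite /nonlocal_op; ring.
apply: le_trans (rnormX_lin _ uhX uKX) _.
rewrite normrN1 mul1r mulrDl lerD ?hC//.
have HuX := inX_scale H uX.
apply: le_trans (_ : nrm (fun x => H * u x) <= _).
  apply: le_rnormX => //; apply: forallX_mono hH => x hx.
  by rewrite !normrM (ger0_norm H0) ler_wpM2r.
by apply: le_trans (rnormXZ _ uX) _; rewrite ger0_norm.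
Qed.

Lemma kernel_op_ge0 u x : (forall y, 0 <= u y) -> 0 <= kernel_op mu J u x.
Proof. by move=> u0; apply: Rintegral_ge0 => y _; rewrite mulr_ge0. Qed.

(** The basic estimate: one explicit Euler step enlarges the negative part by a
    factor at most 1 + c s, up to the local error of the step. *)
Lemma rnormX_funrneg_step : exists2 c, 0 <= c &
  \forall s \near 0^'+, forall u v, inX mu X u -> inX mu X v ->
    nrm v^\- <= (1 + c * s) * nrm u^\- +
                nrm (fun x => v x - u x - s * A u x).
Proof.
have [H H0 hH] := multiplier_bound h_mul.
have [C C0 hC] := blo_rnormX K_blo.
exists (H + C); first exact: addr_ge0.
near=> s => u v uX vX.
have s0 : 0 < s by near: s; exact: nbhs_right_gt.
(* H + 1 rather than H makes the threshold on s finite when H = 0 *)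
have sH : s * (H + 1) <= 1.
  rewrite -ler_pdivlMr ?ltr_wpDl// mul1r.
  by near: s; apply: nbhs_right_le; rewrite invr_gt0 ltr_wpDl.
pose r x := v x - u x - s * A u x.
have pX := inX_funrpos uX.
have nX := inX_funrneg uX.
have KnX := blo_inX K_blo nX.
have AX := blo_inX nonlocal_op_blo uX.
have rX : inX mu X r.
  by apply: inX_sub; [exact: inX_sub|exact: inX_scale].
have arX := inX_abs rX.
have wX := inX_lin s KnX arX.
(* kernel_op is split along u = u^+ - u^- because u^+ and u^- are nonnegative at
   every point, so that their images are nonnegative integrals *)
have lin := blo_linear K_blo (-1) nX pX.
rewrite (_ : (fun x => -1 * _ + _) = u) in lin; last first.
  apply/funext => x; rewrite /funrpos /funrneg.
  by case: (leP 0 (u x)) => ?; case: (leP 0 (- u x)) => ?; lra.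
have /le_trans : nrm v^\- <= nrm (fun x => (1 + s * H) * u^\- x +
    (s * kernel_op mu J u^\- x + `|r x|)).
  apply: le_rnormX; [exact: inX_funrneg|exact: inX_lin|].
  apply: forallX_mono (forallX_and hH lin) => x [hx Kx].
  have Kp0 : 0 <= kernel_op mu J u^\+ x by exact: kernel_op_ge0.
  have Kn0 : 0 <= kernel_op mu J u^\- x by exact: kernel_op_ge0.
  have n0 : 0 <= u^\- x by [].
  have p0 : 0 <= u^\+ x by [].
  have sH0 : 0 <= s * H by rewrite mulr_ge0// ltW.
  have w0 : 0 <= (1 + s * H) * u^\- x + (s * kernel_op mu J u^\- x + `|r x|).
    by rewrite !addr_ge0// ?mulr_ge0// ?addr_ge0// ltW.
  rewrite ger0_norm// (ger0_norm w0) {1}/funrneg ge_max w0 andbT.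
  have uE : u x = u^\+ x - u^\- x.
    rewrite /funrpos /funrneg.
    by case: (leP 0 (u x)) => ?; case: (leP 0 (- u x)) => ?; lra.
  have rx : v x = u x + s * A u x + r x by rewrite /r; ring.
  have := ler_norm (- r x); rewrite normrN => rn.
  have [hl hu] : - H <= h x /\ h x <= H.
    by move: hx; rewrite ler_norml => /andP.
  have sh1 : s * h x <= 1.
    by apply: le_trans sH; rewrite ler_pM2l// (le_trans hu)// lerDl.
  have sh2 : - (s * H) <= s * h x by rewrite -mulrN ler_pM2l.
  have t1 : 0 <= (1 - s * h x) * u^\+ x by rewrite mulr_ge0// subr_ge0.
  have t2 : 0 <= (s * H + s * h x) * u^\- x by rewrite mulr_ge0//; lra.
  have t3 : 0 <= s * kernel_op mu J u^\+ x by rewrite mulr_ge0// ltW.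
  have -> : - v x = - ((1 - s * h x) * u^\+ x) + (1 - s * h x) * u^\- x
      - s * kernel_op mu J u^\+ x + s * kernel_op mu J u^\- x - r x.
    by rewrite rx /nonlocal_op Kx uE; ring.
  lra.
apply; apply: le_trans (rnormX_lin _ nX wX) _.
have -> : (1 + (H + C) * s) * nrm u^\- =
  (1 + s * H) * nrm u^\- + s * (C * nrm u^\-) by ring.
rewrite -addrA ger0_norm ?addr_ge0 ?mulr_ge0 ?(ltW s0)// lerD2l.
apply: le_trans (rnormX_lin _ KnX arX) _.
rewrite (ger0_norm (ltW s0)) lerD ?ler_pM2l ?hC//.
by apply: le_rnormX => //; apply: forallXW => x; rewrite normr_id.
Unshelve. all: by end_near. Qed.

(** The curve [u] satisfies u' = A u in X up to an error of norm at most [eta].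
    The constant [L] is independent of the curve, which is what allows [eta] to
    tend to 0 along the partial sums of the exponential series. *)
Lemma approximate_maximum_principle : exists L : R,
  forall (u0 : T -> R) (u : R -> T -> R) (b eta : R), 0 <= b -> 0 <= eta ->
  inX mu X u0 -> nonnegX mu X u0 ->
  (forall t, 0 <= t -> inX mu X (u t)) -> eqX mu X (u 0) u0 ->
  (forall e, 0 < e -> \forall t \near 0^'+, nrm (fun x => u t x - u0 x) <= e) ->
  (forall t e, 0 < t -> t <= b -> 0 < e -> \forall s \near 0^',
     nrm (fun x => s^-1 * (u (t + s) x - u t x) - A (u t) x) <= eta + e) ->
  nrm (u b)^\- <= eta * expR (L * b).
Proof.
have [c c0 step] := rnormX_funrneg_step.
exists (c + 1) => u0 u b eta b0 eta0 u0X u0_ge0 uX uinit ucvg uder.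
have AX := blo_inX nonlocal_op_blo.
move: b0; rewrite le_eqVlt => /predU1P[bE|b0].
  rewrite -bE rnormX_funrneg0 ?mulr_ge0 ?expR_ge0//; first exact: uX.
  apply: forallX_mono (forallX_and uinit u0_ge0).
  by move=> x [->].
(* the bound is first proved with eta + e / E, which absorbs the o(1) term of
   the derivative and is positive even if eta = 0 *)
apply/ler_addgt0Pr => e e0.
pose E := expR ((c + 1) * b); have E0 : 0 < E by exact: expR_gt0.
have -> : eta * E + e = (eta + e / E) * E by field; exact: lt0r_neq0.
have eE : 0 < e / E by exact: divr_gt0.
apply: (gronwall_one_sided (phi := fun t => nrm (u t)^\-)) => //=.
- by rewrite ltr_wpDl.
- move=> e' e'0; have := ucvg _ e'0.
  apply: filter_app; near=> t => ut.
  have t0 : 0 < t by near: t; exact: nbhs_right_gt.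
  have utX := uX _ (ltW t0).
  apply: le_trans (rnormX_funrneg_le utX u0X) _.
  rewrite rnormX_funrneg0// add0r; apply: le_trans ut; apply: le_rnormX.
  + exact: inX_sub.
  + exact: inX_sub.
  + by apply: forallXW => x; rewrite distrC.
- move=> t e' t0 tb e'0; have := near_dnbhs_left (uder t 1 t0 tb ltr01).
  apply: filter_app; near=> s => us.
  have s0 : 0 < s by near: s; exact: nbhs_right_gt.
  have st : s < t by near: s; exact: nbhs_right_lt.
  have utX := uX _ (ltW t0).
  have utsX : inX mu X (u (t - s)) by apply: uX; rewrite subr_ge0 ltW.
  apply: le_trans (rnormX_funrneg_le utX utsX) _; rewrite lerD2l.
  have AutX := AX _ utX.
  (* left semicontinuity: ||u(t - s) - u(t)|| is at most s times the norm of a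
     difference quotient, which stays bounded *)
  pose q x := (- s)^-1 * (u (t - s) x - u t x) - A (u t) x.
  have qX : inX mu X q by apply: inX_sub => //; apply: inX_scale; exact: inX_sub.
  have -> : (fun x => u (t - s) x - u t x) =
      (fun x => (- s) * (1 * q x + A (u t) x)).
    by apply/funext => x; rewrite /q; field; exact: lt0r_neq0.
  have sumX := inX_lin 1 qX AutX.
  apply: le_trans (rnormXZ _ sumX) _.
  rewrite normrN gtr0_norm//.
  apply: (@le_trans _ _ (s * (eta + 1 + nrm (A (u t))))).
    rewrite ler_pM2l//; apply: le_trans (rnormX_lin _ qX AutX) _.
    by rewrite normr1 mul1r lerD2r.
  rewrite -ler_pdivlMr; last by rewrite ltr_pwDl ?rnormX_ge0// ltr_wpDl.
  near: s.
  by apply: nbhs_right_le; rewrite divr_gt0// ltr_pwDl ?rnormX_ge0// ltr_wpDl.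
- move=> t t0 tb; have := near_dnbhs_right (uder t _ t0 (ltW tb) eE).
  apply: filter_app; move: step; apply: filter_app; near=> s => step us.
  have s0 : 0 < s by near: s; exact: nbhs_right_gt.
  have utX := uX _ (ltW t0).
  have utsX : inX mu X (u (t + s)) by apply: uX; rewrite addr_ge0 ?ltW.
  apply: le_trans (step _ _ utX utsX) _; rewrite lerD2l.
  have AutX := AX _ utX.
  pose q x := s^-1 * (u (t + s) x - u t x) - A (u t) x.
  have qX : inX mu X q by apply: inX_sub => //; apply: inX_scale; exact: inX_sub.
  have -> : (fun x => u (t + s) x - u t x - s * A (u t) x) = (fun x => s * q x).
    by apply/funext => x; rewrite /q; field; exact: lt0r_neq0.
  apply: le_trans (rnormXZ _ qX) _.
  by rewrite gtr0_norm// mulrC ler_pM2r.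
Unshelve. all: by end_near. Qed.

End MaximumPrinciple.

(** * Partial sums of the exponential series *)

Definition exp_sum (R : realType) (T : Type) (A : (T -> R) -> T -> R)
    (u0 : T -> R) (n : nat) (t : R) : T -> R :=
  fun x => \sum_(k < n) exp_coeff t k * iter k A u0 x.

Section ExponentialSeries.
Context (d : measure_display) (R : realType) (T : measurableMetricType d R).
Context (mu : {measure set T -> \bar R}) (X : function_space R).
Local Notation nrm := (rnormX mu X).

Context (A : (T -> R) -> T -> R) (u0 : T -> R).
Context (A_blo : bounded_linear_op mu X A) (u0X : inX mu X u0).

Lemma inX_iter k : inX mu X (iter k A u0).
Proof. by elim: k => //= k; apply: (blo_inX A_blo). Qed.

Lemma inX_exp_sum n t : inX mu X (exp_sum A u0 n t).
Proof. exact: inX_sum inX_iter. Qed.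

Lemma exp_sum0 m : exp_sum A u0 m.+1 0 = u0.
Proof.
apply/funext => x; rewrite /exp_sum big_ord_recl/= /exp_coeff /= expr0.
rewrite fact0 divr1 mul1r big1 ?addr0// => i _.
by rewrite /= expr0n /= mul0r mul0r.
Qed.

Lemma exp_sum_cvg0 m e : 0 < e ->
  \forall t \near 0^'+, nrm (fun x => exp_sum A u0 m.+1 t x - u0 x) <= e.
Proof.
move=> e0; apply: filterS (rnormX_sum_near m.+1 inX_iter
  (@exp_coeff_cvg0 R) e0) => t; congr (nrm _ <= _); apply/funext => x.
have <- : exp_sum A u0 m.+1 0 x = u0 x by rewrite exp_sum0.
rewrite /exp_sum -sumrB.
by apply: eq_bigr => k _; rewrite mulrBl.
Qed.

(** Differentiating term by term shifts the coefficients by one index, whereas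
    applying A shifts the iterates; the two sums telescope and leave only the
    last term, t^m/m! A^(m+1) u0. *)
Lemma exp_sum_deriv m b t e : 0 <= t -> t <= b -> 0 < e ->
  \forall s \near 0^', nrm (fun x =>
    s^-1 * (exp_sum A u0 m.+1 (t + s) x - exp_sum A u0 m.+1 t x) -
    A (exp_sum A u0 m.+1 t) x) <= exp_coeff b m * nrm (iter m.+1 A u0) + e.
Proof.
move=> t0 tb e0.
apply: filterS (rnormX_sum_near m.+1 inX_iter
  (fun k => exp_coeff_quotient_cvg k t) e0) => s.
set q := (fun x => \sum_(k < _) _) => qe.
have qX : inX mu X q.
  exact: (inX_sum m.+1 (fun k => s^-1 * (exp_coeff (t + s) k -
    exp_coeff t k) - prev_exp_coeff t k) inX_iter).
have rX := inX_lin (- exp_coeff t m) (inX_iter m.+1) qX.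
rewrite (rnormX_ext _ rX).
- apply: le_trans (rnormX_lin _ (inX_iter m.+1) qX) _.
  rewrite lerD// normrN ger0_norm ?divr_ge0 ?exprn_ge0// ler_wpM2r ?rnormX_ge0//.
  by rewrite ler_wpM2r ?invr_ge0// lerXn2r// nnegrE// (le_trans t0).
- apply: inX_sub; last by apply: (blo_inX A_blo); exact: inX_exp_sum.
  by apply: inX_scale; apply: inX_sub; exact: inX_exp_sum.
apply: forallX_mono (blo_sum m.+1 (exp_coeff t) A_blo inX_iter).
move=> x; rewrite -/(exp_sum A u0 m.+1 t) => ->.
have tel : \sum_(k < m.+1) prev_exp_coeff t k * iter k A u0 x =
    \sum_(k < m.+1) exp_coeff t k * A (iter k A u0) x
    - exp_coeff t m * iter m.+1 A u0 x.
  rewrite big_ord_recl/= mul0r add0r big_ord_recr/= addrK.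
  by apply: eq_bigr => k _.
have qE : q x = s^-1 * (exp_sum A u0 m.+1 (t + s) x - exp_sum A u0 m.+1 t x)
    - \sum_(k < m.+1) prev_exp_coeff t k * iter k A u0 x.
  rewrite /q /exp_sum -sumrB mulr_sumr -sumrB; apply: eq_bigr => k _.
  by ring.
by rewrite qE tel; ring.
Qed.

(** Since ||A^(m+1) u0|| <= M^(m+1) ||u0||, the error is dominated by the
    general term of the series of e^{|b| M}, up to a constant factor. *)
Lemma exp_sum_error_cvg0 b e : 0 < e ->
  \forall m \near \oo, exp_coeff b m * nrm (iter m.+1 A u0) < e.
Proof.
move=> e0; have [M M0 hM] := blo_rnormX A_blo.
have it m : nrm (iter m A u0) <= M ^+ m * nrm u0.
  elim: m => [|m ih] /=; first by rewrite expr0 mul1r.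
  apply: le_trans (hM _ (inX_iter m)) _.
  by rewrite exprS -mulrA ler_wpM2l.
have c0 : (fun m => exp_coeff (`|b| * M) m * (M * nrm u0)) @ \oo --> 0.
  have cst : (fun=> M * nrm u0) @ \oo --> M * nrm u0 by exact: cvg_cst.
  by have /(_ _) := cvgM (@cvg_exp_coeff _ (`|b| * M)) cst; rewrite mul0r.
have /cvgr0_norm_lt/(_ _ e0) := c0; apply: filterS => m /=.
apply: le_lt_trans; apply: le_trans _ (ler_norm _).
apply: (@le_trans _ _ (`|exp_coeff b m| * (M ^+ m.+1 * nrm u0))).
  apply: (@le_trans _ _ (`|exp_coeff b m| * nrm (iter m.+1 A u0))).
    by rewrite ler_wpM2r ?rnormX_ge0// ler_norm.
  by rewrite ler_wpM2l.
rewrite /exp_coeff /= normrM normfV normrX [`|_%:R|]ger0_norm//.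
by rewrite exprMn exprS le_eqVlt; apply/orP; left; apply/eqP; ring.
Qed.

End ExponentialSeries.

Unset Implicit Arguments.
Set Strict Implicit.

(** * The weak maximum principle *)

Theorem proposition4p2 (d : measure_display) (R : realType)
    (T : measurableMetricType d R) (mu : {measure set T -> \bar R})
    (X : function_space R) (J : T -> T -> R) (h u0 : T -> R) :
  metric_measure_space mu ->
  (forall x y, 0 <= J x y) ->
  kernel_op_defined mu X J ->
  bounded_linear_op mu X (kernel_op mu J) ->
  multiplierX mu X h ->
  inX mu X u0 ->
  nonnegX mu X u0 ->
  (forall (t : R) (v : T -> R), 0 <= t ->
     is_exp_op mu X (nonlocal_op mu J h) t u0 v -> nonnegX mu X v) /\
  (forall u : R -> T -> R,
     is_solution mu X (nonlocal_op mu J h) u0 u ->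
     forall t : R, 0 <= t -> nonnegX mu X (u t)).
Proof.
move=> _ J0 _ K_blo h_mul u0X u0_ge0.
have A_blo := nonlocal_op_blo K_blo h_mul.
have [L principle] :=
  approximate_maximum_principle J0 K_blo h_mul.
split=> [t v t0 [vX v_cvg]|u [uX uinit ucvg uder] t t0].
  apply: nonnegX_funrneg => //; apply/ler_addgt0Pr => e e0; rewrite add0r.
  pose S := exp_sum (nonlocal_op mu J h) u0.
  have SX n := inX_exp_sum A_blo u0X n t.
  have e2 : 0 < e / 2 by exact: divr_gt0.
  have E0 : 0 < expR (L * t) by exact: expR_gt0.
  have [N _ hN] := cvg_normX_near v_cvg e2.
  near \oo => m.
  have Sv : rnormX mu X (fun x => S m.+1 t x - v x) < e / 2.
    apply: hN; rewrite /=; apply: leqW; near: m; exact: nbhs_infty_ge.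
  have Sneg : rnormX mu X (S m.+1 t)^\- <= e / 2.
    pose eta := exp_coeff t m *
      rnormX mu X (iter m.+1 (nonlocal_op mu J h) u0).
    apply: (@le_trans _ _ (eta * expR (L * t))).
      apply: (principle u0 (S m.+1)) => //.
      - by rewrite mulr_ge0 ?rnormX_ge0// divr_ge0 ?exprn_ge0.
      - by move=> s _; exact: inX_exp_sum.
      - by rewrite /S exp_sum0; exact: forallXW.
      - by move=> e' e'0; exact: exp_sum_cvg0.
      - by move=> s e' s0 st e'0; apply: exp_sum_deriv => //; exact: ltW.
    rewrite -ler_pdivlMr// /eta; apply/ltW; near: m.
    by apply: (exp_sum_error_cvg0 A_blo u0X); exact: divr_gt0.
  apply: le_trans (rnormX_funrneg_le vX (SX m.+1)) _.
  by rewrite (splitr e) lerD// ltW.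
apply: nonnegX_funrneg; first exact: uX.
rewrite -(mul0r (expR (L * t))); apply: (principle u0) => //.
- move=> e e0.
  apply: filterS (cvg_normX_near ucvg e0) => s.
  exact: ltW.
- move=> s e s0 st e0.
  apply: filterS (cvg_normX_near (uder s s0) e0) => r.
  by rewrite add0r; exact: ltW.
Unshelve. all: by end_near. Qed.
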